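(* Let $b$, $k$ and $n$ be positive integers and let $p=\frac{b+k}{\gcd(b,k)}$. Let $A=(a_{ij})$ be an $n\times n$ complex matrix such that $a_{ij}=0$ whenever $i-j\neq b$ and $i-j\neq -k$. Then the spectrum of $A$ is invariant under rotations by $2\pi/p$. If, in addition, every $a_{ij}$ is real and nonnegative, then the eigenvalues of $A$ are all of the form $r\,e^{i2\pi j/p}$, where $r$ is a nonnegative real number and $j$ is an integer.
   Context: In the exponent $e^{i2\pi j/p}$, $i$ denotes the imaginary unit. Invariance of the spectrum under rotations by $2\pi/p$ means invariance under multiplication by $e^{i2\pi/p}$ in the complex plane. *)

(* Defs.v *)
From HB Require Import structures.
From mathcomp Require Import all_boot all_order all_algebra.
From mathcomp Require Import complex.
From mathcomp Require Import boolp classical_sets reals trigo.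

Set Implicit Arguments.
Unset Strict Implicit.
Unset Printing Implicit Defensive.

Import Order.TTheory GRing.Theory Num.Theory.
Local Open Scope classical_set_scope.
Local Open Scope ring_scope.
Local Open Scope complex_scope.

(* [expi t] is e^{i t} for real t, by Euler's formula: MathComp-Analysis has no
   complex exponential. *)
Definition expi (R : realType) (t : R) : R[i] := cos t +i* sin t.

(* [eigenvalue] uses row vectors (v *m A = z *: v with v != 0); over a field
   this gives the same eigenvalues as column vectors. *)
Definition spectrum (R : realType) (n : nat) (A : 'M[R[i]]_n) : set R[i] :=
  [set z | eigenvalue A z].

(* The rotation of the complex plane about 0 by the angle t maps S onto S. *)
Definition rotation_invariant (R : realType) (t : R) (S : set R[i]) : Prop :=
  [set expi t * z | z in S] = S.

(* Main.v *)
Require Import Defs.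
From HB Require Import structures.
From mathcomp Require Import all_boot all_order all_algebra.
From mathcomp Require Import complex.
From mathcomp Require Import boolp classical_sets reals trigo.
From mathcomp Require Import zify ring lra.
Set Implicit Arguments.
Unset Strict Implicit.
Unset Printing Implicit Defensive.

Import Order.TTheory GRing.Theory Num.Theory.
Local Open Scope classical_set_scope.
Local Open Scope ring_scope.
Local Open Scope complex_scope.

(** Both halves rest on reading the indices modulo [b + k]: an entry [A i j]
can be nonzero only if [i = j + b] or [j = i + k], and either way
[i] is congruent to [j + b] modulo [b + k].

For the rotation, divide the indices by [g = gcd(b, k)]. A nonzero entry
raises [j %/ g] by [b/g] or lowers it by [k/g], which is the same thing modulo
[p]; as [b/g] is invertible modulo [p], rescaling the quotient gives a grading
for which every nonzero entry has degree one. Conjugating [A] by the diagonal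
matrix of the corresponding powers of [w], a primitive [p]-th root of unity,
therefore multiplies [A] by [w].

For nonnegative [A], let [v] be a left eigenvector for [z], and keep only the
coordinates [x] of [v] in a residue class modulo [b + k] on which [v] is not
zero. Since [p * b] is divisible by [b + k], this gives
[x *m A ^+ p = z ^+ p *: x], and it is enough to prove [z ^+ p >= 0]
([eigenvalue_expr_ge0]). Between two consecutive residue classes [A] acts as a
nonnegative bidiagonal matrix, hence diminishes sign variation: each step
keeps or lowers the maximal length of an alternating sequence of coordinates
([alternation_mulmx]). When the length is kept, the sign at which maximal
sequences start is kept too, and this is the sign of the first nonzero
coordinate.

Apply this to the real vectors [Re (al * x)] with [al] complex. Choose one
whose sign variation is minimal. Along its whole forward orbit the variation
cannot drop, so the first nonzero coordinate never changes sign
([persistent_leading_sign]). For [mu = z ^+ p], the orbit is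
[Re (al * mu ^+ m * x)], so its leading coordinate is a sequence of constant
sign that satisfies the recurrence with characteristic polynomial
[X^2 - 2 Re(mu) X + |mu|^2]. If [Re mu < |mu|], then
after division by [|mu| ^+ m] its second differences are negative multiples of
its values; such a sequence cannot keep a constant sign without vanishing
([nonneg_recurrence]). So [Re mu = |mu|], that is, [mu >= 0], and [z / |z|] is a
[p]-th root of unity ([nonneg_expr_polar]). *)

(** * Bands modulo b + k *)

Definition two_banded (b k n : nat) (R : nzRingType) (A : 'M[R]_n) : Prop :=
  forall i j : 'I_n, A i j != 0 -> (i = j + b :> nat)%N \/ (j = i + k :> nat)%N.

Lemma two_banded_mod (b k n : nat) (R : nzRingType) (A : 'M[R]_n) (i j : 'I_n) :
  two_banded b k A -> A i j != 0 -> (j + b = i %[mod (b + k)])%N.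
Proof.
move=> Aband /Aband[->|->]; first by [].
by rewrite -addnA [(k + b)%N]addnC modnDr.
Qed.

Definition restrict_residue (K : nzRingType) (n d c : nat) (v : 'rV[K]_n) :
    'rV[K]_n :=
  \row_j (if (j == c %[mod d])%N then v 0 j else 0).

(** [A] sends the class of [c + b] to the class of [c], so the restrictions of
an eigenvector to the successive classes form a chain under [A]. When [m * b]
is divisible by [b + k] the chain closes up, and a single restriction becomes
an eigenvector of [A ^+ m]. *)
Lemma restrict_residue_mulmxX (b k n m c : nat) (K : comNzRingType)
    (A : 'M[K]_n) (v : 'rV[K]_n) (z : K) :
  two_banded b k A -> v *m A = z *: v ->
  restrict_residue (b + k) (c + m * b) v *m A ^+ m
    = z ^+ m *: restrict_residue (b + k) c v.
Proof.
move=> Aband vA; elim: m c => [|m IH] c.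
  by rewrite mul0n addn0 !expr0 mulmx1 scale1r.
have step e : restrict_residue (b + k) (e + b) v *m A =
    z *: restrict_residue (b + k) e v.
  apply/rowP => j; rewrite !mxE.
  transitivity (if (j == e %[mod b + k])%N then (v *m A) 0 j else 0); last first.
    by rewrite vA mxE; case: ifP; rewrite ?mulr0.
  have res i : A i j != 0 ->
      (i == e + b %[mod b + k])%N = (j == e %[mod b + k])%N.
    by move=> /(two_banded_mod Aband) <-; rewrite eqn_modDr.
  case: ifP => je; rewrite ?mxE; [apply: eq_bigr => i _ | apply: big1 => i _];
    rewrite mxE; have [->|Aij] := eqVneq (A i j) 0; rewrite ?mulr0 //;
    rewrite res // je //.
  by rewrite mul0r.
by rewrite exprS mulmxA mulSnr addnA step -scalemxAl IH scalerA exprS.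
Qed.

(** * Rotation of the spectrum *)

(** Conjugation by the diagonal matrix of the [w ^+ f i] multiplies [A] by [w];
on row vectors it amounts to scaling the [i]-th coordinate. *)
Lemma twisted_spectrum (R : realType) (n : nat) (A : 'M[R[i]]_n) (w : R[i])
    (f : 'I_n -> nat) (z : R[i]) :
  w != 0 -> (forall i j, A i j != 0 -> w ^+ f i = w ^+ (f j).+1) ->
  spectrum A z -> spectrum A (w * z).
Proof.
move=> w0 fA /eigenvalueP[v vA vnz].
apply/eigenvalueP; exists (\row_i (v 0 i * w ^+ f i)).
  apply/rowP => j; rewrite !mxE.
  have := congr1 (fun u : 'rV_n => u 0 j) vA; rewrite !mxE => vj.
  rewrite -mulrA [z * _]mulrA -vj mulrCA -exprS mulr_suml.
  apply: eq_bigr => i _; rewrite !mxE.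
  have [->|Aij] := eqVneq (A i j) 0; first by rewrite !mulr0 mul0r.
  by rewrite (fA _ _ Aij) mulrAC.
have /rV0Pn[i vi] := vnz; apply/rV0Pn; exists i.
by rewrite mxE mulf_neq0 // expf_neq0.
Qed.

(** The grading is [c * (i %/ g)], with [g] the gcd of [b] and [k], and [c] an
inverse of [b %/ g] modulo [p]: moving by [b] adds [c * (b %/ g)], that is,
[1] modulo [p], and moving by [- k] has the same effect since [b %/ g + k %/ g = p]. *)
Lemma two_banded_grading (b k n : nat) (K : fieldType) (A : 'M[K]_n) (w : K) :
  (0 < b)%N -> (0 < k)%N -> two_banded b k A ->
  ((b + k) %/ gcdn b k).-primitive_root w ->
  exists f : 'I_n -> nat, forall i j, A i j != 0 -> w ^+ f i = w ^+ (f j).+1.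
Proof.
move=> b0 k0 Aband; set g := gcdn b k.
have g0 : (0 < g)%N by rewrite gcdn_gt0 b0.
have [b' bE] : exists b', b = (b' * g)%N by apply/dvdnP; exact: dvdn_gcdl.
have [k' kE] : exists k', k = (k' * g)%N by apply/dvdnP; exact: dvdn_gcdr.
have b'0 : (0 < b')%N by move: b0; rewrite bE; case: (b').
have cop : coprime b' (b' + k').
  have : (g * gcdn b' k')%N = g by rewrite muln_gcdr ![(g * _)%N]mulnC -bE -kE.
  by rewrite /coprime gcdnDl => /eqP; rewrite -[X in _ == X]muln1 eqn_pmul2l.
have -> : ((b + k) %/ g = b' + k')%N by rewrite {1}bE {1}kE -mulnDl mulnK.
move=> wprim; have wp := prim_expr_order wprim.
have [[c c'] /= cb] := coprimeP (b' + k') b'0 cop.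
have wcb : w ^+ (c * b') = w.
  have -> : (c * b' = (b' + k') * c' + 1)%N.
    by rewrite mulnC; move: cb; rewrite [(c * b')%N]mulnC; lia.
  by rewrite exprD exprM wp expr1n mul1r expr1.
have wck : w ^+ (c * k') * w = 1.
  rewrite -[X in _ * X]wcb -exprD -mulnDr [(k' + b')%N]addnC mulnC exprM wp.
  by rewrite expr1n.
exists (fun i => c * (i %/ g))%N => i j /Aband[ij|ij].
  have -> : (i %/ g = j %/ g + b')%N.
    by rewrite ij {1}bE [(_ + b' * g)%N]addnC divnMDl // addnC.
  by rewrite mulnDr exprD wcb -exprSr.
have -> : (j %/ g = i %/ g + k')%N.
  by rewrite ij {1}kE [(_ + k' * g)%N]addnC divnMDl // addnC.
by rewrite exprSr mulnDr exprD -mulrA wck mulr1.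
Qed.

(** Inclusion is enough: the inverse of a rotation of finite order is one of
its powers. *)
Lemma rotation_invariant_root (R : realType) (t : R) (p : nat) (S : set R[i]) :
  (0 < p)%N -> expi t ^+ p = 1 -> (forall z, S z -> S (expi t * z)) ->
  rotation_invariant t S.
Proof.
move=> p0 tp Sw; apply/seteqP; split=> [_ [z Sz <-]|z Sz]; first exact: Sw.
exists (expi t ^+ p.-1 * z); last by rewrite mulrA -exprS prednK // tp mul1r.
elim: p.-1 => [|m IH]; first by rewrite mul1r.
by rewrite exprS -mulrA; apply: Sw.
Qed.

(** * Alternating sequences of coordinates *)

(** The Boolean [e] is the sign, [(-1) ^+ e], of the first listed coordinate. *)
Fixpoint alternates (R : realType) (n : nat) (u : 'rV[R]_n) (e : bool)
    (s : seq 'I_n) : bool :=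
  if s is i :: s' then (0 < (-1) ^+ e * u 0 i) && alternates u (~~ e) s'
  else true.

Definition alternation (R : realType) (n : nat) (u : 'rV[R]_n) (e : bool)
    (s : seq 'I_n) : bool :=
  sorted (fun i j : 'I_n => (i < j)%N) s && alternates u e s.

Lemma alternation_size (R : realType) (n : nat) (u : 'rV[R]_n) (e : bool)
    (s : seq 'I_n) :
  alternation u e s -> (size s <= n)%N.
Proof.
move=> /andP[ss _].
have us : uniq s.
  apply: (sorted_uniq _ _ ss) => [x y z /=|x /=]; [|exact: ltnn].
  exact: ltn_trans.
rewrite -[leqRHS]card_ord -(card_uniqP us); exact: max_card.
Qed.

Lemma alternation_cons (R : realType) (n : nat) (u : 'rV[R]_n) (e : bool)
    (i j : 'I_n) (s : seq 'I_n) :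
  (i < j)%N -> 0 < (-1) ^+ e * u 0 i -> alternation u (~~ e) (j :: s) ->
  alternation u e [:: i, j & s].
Proof. by rewrite /alternation /= => -> -> /andP[-> ->]. Qed.

(** The two sequences start at distinct indices because the signs there
differ, so the earlier of the two starting indices can be prepended to the
other sequence. Hence all alternating sequences of maximal length start with
the same sign. *)
Lemma alternation_extend (R : realType) (n : nat) (u : 'rV[R]_n) (e : bool)
    (s s' : seq 'I_n) :
  size s = size s' -> (0 < size s)%N ->
  alternation u e s -> alternation u (~~ e) s' ->
  exists e' t, alternation u e' t /\ size t = (size s).+1.
Proof.
case: s => // i s; case: s' => // i' s' ss' _ a a'.
have ui : 0 < (-1) ^+ e * u 0 i by case/and3P: a.
have ui' : 0 < (-1) ^+ (~~ e) * u 0 i' by case/and3P: a'.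
case: (ltngtP i i') => ii'.
- exists e, [:: i, i' & s']; split; first exact: alternation_cons.
  by case: ss' => /= ->.
- exists (~~ e), [:: i', i & s]; split=> //.
  by apply: alternation_cons => //; rewrite negbK.
- move: ui' ui; rewrite -(val_inj ii') signrN mulNr oppr_gt0 => /lt_trans h /h.
  by rewrite ltxx.
Qed.

(** Weak monotonicity of [f] suffices: consecutive terms have opposite signs,
so their images under [f] are distinct. *)
Lemma alternation_pullback (R : realType) (n : nat) (u w : 'rV[R]_n)
    (f : 'I_n -> 'I_n) :
  (forall j, w 0 j != 0 -> 0 < w 0 j * u 0 (f j)) ->
  (forall j j' : 'I_n, w 0 j != 0 -> w 0 j' != 0 -> (j < j')%N ->
     (f j <= f j')%N) ->
  forall e s, alternation w e s -> alternation u e (map f s).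
Proof.
move=> fw fm.
have fs e j : 0 < (-1) ^+ e * w 0 j ->
    w 0 j != 0 /\ 0 < (-1) ^+ e * u 0 (f j).
  move=> wj; have nz : w 0 j != 0.
    by apply: contraTneq wj => ->; rewrite mulr0 ltxx.
  split=> //; have := mulr_gt0 wj (fw _ nz).
  rewrite mulrA -[_ * w 0 j * w 0 j]mulrA -expr2 mulrAC [X in 0 < X]mulrC.
  by rewrite pmulr_rgt0 // exprn_even_gt0.
move=> e s; elim: s e => [|j s IH] e //= /andP[/= js /= /andP[wj ws]].
have [nzj uj] := fs _ _ wj.
have := IH (~~ e); rewrite /alternation ws andbT.
case: s js ws {IH} => [|j' s] /=; first by rewrite uj.
move=> /andP[jj' js'] /andP[wj' _] /(_ js') H.
have [nzj' uj'] := fs _ _ wj'.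
apply: (alternation_cons _ uj H).
rewrite ltn_neqAle (fm _ _ nzj nzj' jj') andbT.
apply/eqP => /val_inj fjj'; move: uj' uj.
rewrite fjj' signrN mulNr oppr_gt0 => /lt_trans h /h.
by rewrite ltxx.
Qed.

(** * Minimal sign variation along an orbit *)

(** The abstract form of the minimality argument. [T] does not lengthen
alternating sequences; starting from a [u] in [K] whose maximal length [l] is
least, the maximal length remains [l] on the orbit. A maximal sequence of
[T v] yields a maximal sequence of [v] starting with the same sign, and the
maximal sequences of one vector share their starting sign, so this sign is
constant on the orbit. A leading coordinate of the opposite sign could be
prepended to a maximal sequence. *)
Lemma persistent_leading_sign (R : realType) (n : nat)
    (K : 'rV[R]_n -> Prop) (T : 'rV[R]_n -> 'rV[R]_n) (u0 : 'rV[R]_n) :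
  K u0 -> (forall u, K u -> K (T u)) -> (forall u, K u -> u != 0) ->
  (forall u e s, K u -> alternation (T u) e s ->
     exists2 s', size s' = size s & alternation u e s') ->
  exists u e, K u /\ forall m (j : 'I_n),
    (forall i : 'I_n, (i < j)%N -> iter m T u 0 i = 0) ->
    0 <= (-1) ^+ e * iter m T u 0 j.
Proof.
move=> Ku0 KT Knz Tdim.
pose P l := `[< exists2 u, K u &
                 forall e s, alternation u e s -> (size s <= l)%N >].
have exP : exists l, P l.
  by exists n; apply/asboolP; exists u0 => // e s /alternation_size.
case: (ex_minnP exP) => l /asboolP[u Ku ul] lmin.
have Kit m : K (iter m T u) by elim: m => //= m; apply: KT.
have bound m e s : alternation (iter m T u) e s -> (size s <= l)%N.
  elim: m e s => [|m IH] e s; first exact: ul.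
  by move=> /(Tdim _ _ _ (Kit m))[s' <-]; apply: IH.
have l0 : (0 < l)%N.
  have /rV0Pn[i ui] := Knz _ Ku.
  apply: (ul (u 0 i < 0) [:: i]).
  rewrite /alternation /= andbT -normrEsign.
  by rewrite normr_gt0.
(* A shorter maximal length at step m would contradict the choice of l. *)
have attained m : exists e s, alternation (iter m T u) e s /\ size s = l.
  apply: contrapT => no.
  have : P l.-1.
    apply/asboolP; exists (iter m T u) => // e s a.
    rewrite -ltnS prednK // ltn_neqAle (bound _ _ _ a) andbT.
    by apply/eqP => sl; apply: no; exists e, s.
  by move=> /lmin; lia.
have sign m e e' s s' : alternation (iter m T u) e s ->
    alternation (iter m T u) e' s' -> size s = l -> size s' = l -> e = e'.
  move=> a a' sl sl'; apply: contrapT => ee'.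
  have e'E : e' = ~~ e by move: ee'; case: (e); case: (e').
  have [|||e1 [t [at_ st]]] := alternation_extend _ _ a (s' := s').
  - by rewrite sl.
  - by rewrite sl.
  - by rewrite -e'E.
  - by have := bound _ _ _ at_; rewrite st sl ltnn.
have [e [s [a sl]]] := attained 0.
have same m : exists s, alternation (iter m T u) e s /\ size s = l.
  elim: m => [|m [t [at_ st]]]; first by exists s.
  have [e' [t' [at' st']]] := attained m.+1.
  have [t2 st2 at2] := Tdim _ _ _ (Kit m) at'.
  have -> : e = e' by apply: (sign _ _ _ _ _ at_ at2); rewrite ?st2.
  by exists t'.
exists u, e; split=> // m j jlead; rewrite leNgt; apply/negP => neg.
have [[|i t] [at_ st]] := same m; first by move: l0; rewrite -st.
have ui : 0 < (-1) ^+ e * iter m T u 0 i by case/and3P: at_.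
have ij : (j < i)%N.
  rewrite ltnNge leq_eqVlt; apply/negP => /orP[/eqP/val_inj ij|/jlead ui0].
    by move: (lt_trans neg ui); rewrite ij ltxx.
  by move: ui; rewrite ui0 mulr0 ltxx.
have : alternation (iter m T u) (~~ e) [:: j, i & t].
  by apply: alternation_cons => //; rewrite ?negbK // signrN mulNr oppr_gt0.
by move=> /bound; rewrite /= -st /= ltnn.
Qed.

(** * Variation diminishing for nonnegative two-banded matrices *)

Definition one_residue (d n : nat) (R : nzRingType) (u : 'rV[R]_n) : Prop :=
  forall i j : 'I_n, u 0 i != 0 -> u 0 j != 0 -> i = j %[mod d].

(** Otherwise every term of the sum that computes [(u *m B) 0 j] would have
the sign opposite to that sum. *)
Lemma mulmx_same_sign (R : realType) (n : nat) (B : 'M[R]_n) (u : 'rV[R]_n)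
    (j : 'I_n) :
  (forall i j, 0 <= B i j) -> (u *m B) 0 j != 0 ->
  exists i, B i j != 0 /\ 0 < (u *m B) 0 j * u 0 i.
Proof.
set w := u *m B => B0 wj.
have wE : w 0 j = \sum_i u 0 i * B i j by rewrite mxE.
apply: contrapT => no.
have : w 0 j ^+ 2 <= 0.
  rewrite expr2 {2}wE mulr_sumr; apply: sumr_le0 => i _.
  rewrite mulrA; have [->|Bij] := eqVneq (B i j) 0; first by rewrite mulr0.
  rewrite pmulr_lle0 ?lt0r ?Bij ?B0 // leNgt; apply/negP => h.
  by apply: no; exists i.
by rewrite leNgt exprn_even_gt0 ?wj.
Qed.

Lemma one_residue_mulmx (R : realType) (b k n : nat) (B : 'M[R]_n)
    (u : 'rV[R]_n) :
  (forall i j, 0 <= B i j) -> two_banded b k B ->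
  one_residue (b + k) u -> one_residue (b + k) (u *m B).
Proof.
move=> B0 Bband ures j j' /(mulmx_same_sign B0)[i [Bij ui]].
move=> /(mulmx_same_sign B0)[i' [Bij' ui']].
have nz x y : 0 < x * y -> y != 0 :> R.
  by apply: contraTneq => ->; rewrite mulr0 ltxx.
apply/eqP; rewrite -(eqn_modDr b) (two_banded_mod Bband Bij)
  (two_banded_mod Bband Bij').
by apply/eqP; apply: ures; [exact: nz ui | exact: nz ui'].
Qed.

(** Two indices [j < j'] in the support of [u *m B] differ by at least
[b + k]. The first takes its sign from an entry of [u] at an index at most
[j + b], the second from one at an index at least [j' - k], and
[j + b <= j' - k]. So the choice of these indices is monotone, and an
alternating sequence pulls back along it. *)
Lemma alternation_mulmx (R : realType) (b k n : nat) (B : 'M[R]_n)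
    (u : 'rV[R]_n) (e : bool) (s : seq 'I_n) :
  (forall i j, 0 <= B i j) -> two_banded b k B ->
  one_residue (b + k) u -> alternation (u *m B) e s ->
  exists2 s', size s' = size s & alternation u e s'.
Proof.
move=> B0 Bband ures; set w := u *m B.
have sel j : {i | w 0 j != 0 -> B i j != 0 /\ 0 < w 0 j * u 0 i}.
  apply: cid; have [->|/(mulmx_same_sign B0)[i Hi]] := eqVneq (w 0 j) 0.
    by exists j; rewrite ?eqxx.
  by exists i.
pose f j := sval (sel j).
have fB j : w 0 j != 0 -> B (f j) j != 0 by case/(svalP (sel j)).
have fw j : w 0 j != 0 -> 0 < w 0 j * u 0 (f j) by case/(svalP (sel j)).
move=> ws; exists (map f s); first by rewrite size_map.
apply: alternation_pullback ws => // j j' wj wj' jj'.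
have := one_residue_mulmx B0 Bband ures wj wj' => /eqP.
rewrite eq_sym eqn_mod_dvd ?(ltnW jj') // => /dvdn_leq.
rewrite subn_gt0 => /(_ jj').
by case: (Bband _ _ (fB _ wj)) (Bband _ _ (fB _ wj')) => [] ? [] ?; lia.
Qed.

Lemma alternation_mulmxX (R : realType) (b k n m : nat) (B : 'M[R]_n)
    (u : 'rV[R]_n) (e : bool) (s : seq 'I_n) :
  (forall i j, 0 <= B i j) -> two_banded b k B ->
  one_residue (b + k) u -> alternation (u *m B ^+ m) e s ->
  exists2 s', size s' = size s & alternation u e s'.
Proof.
move=> B0 Bband; elim: m u s => [|m IH] u s ures.
  by rewrite expr0 mulmx1; exists s.
rewrite exprS mulmxA => /(IH _ _ (one_residue_mulmx B0 Bband ures))[s1 <-].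
exact: (alternation_mulmx B0 Bband).
Qed.

(** * Eigenvalues with a one-residue eigenvector *)

(** Put [y m = x m / r ^+ m]. If [a < r], then the increments of [y] satisfy
[d m.+1 = d m - k * y m.+1] with [k > 0], so [y] is concave. Being
nonnegative, it is nondecreasing; but then the increments decrease by at least
[k * y 1] at every step, which forces [y 1 = 0], then [y 0 = 0]. *)
Lemma nonneg_recurrence (R : realType) (a r : R) (x : nat -> R) :
  0 < r -> (forall m, 0 <= x m) ->
  (forall m, x m.+2 = 2 * a * x m.+1 - r ^+ 2 * x m) ->
  x 0 != 0 \/ x 1 != 0 -> r <= a.
Proof.
move=> r0 x0 rec nz; rewrite leNgt; apply/negP => ar.
pose y m := x m / r ^+ m.
have exceeds (c z : R) : 0 < z -> exists l, c < z *+ l.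
  move=> z0; exists (Num.Def.archi_bound (`|c| / z)).
  have := archi_boundP (divr_ge0 (normr_ge0 c) (ltW z0)).
  rewrite ltr_pdivrMr // mulr_natl; apply: le_lt_trans; exact: ler_norm.
have y0 m : 0 <= y m by rewrite divr_ge0 // exprn_ge0 // ltW.
pose k := 2 - 2 * a / r.
have k0 : 0 < k.
  rewrite /k subr_gt0 ltr_pdivrMr //; lra.
pose d m := y m.+1 - y m.
have dS m : d m.+1 = d m - k * y m.+1.
  have rm : r ^+ m != 0 by rewrite expf_neq0 // gt_eqF.
  rewrite /d /y rec /k !exprS; field.
  by rewrite rm gt_eqF.
have dle m l : d (m + l)%N <= d m.
  elim: l => [|l IH]; rewrite ?addn0 // addnS dS.
  by rewrite (le_trans _ IH) // gerBl mulr_ge0 // ltW.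
(* A negative increment would persist and drive y below zero. *)
have d0 m : 0 <= d m.
  rewrite leNgt; apply/negP => dm.
  have yle l : y (m + l)%N <= y m + d m *+ l.
    elim: l => [|l IH]; first by rewrite addn0 mulr0n addr0.
    rewrite addnS mulrS.
    by have := dle m l; rewrite /d in IH *; lra.
  have [l] : exists l, y m < (- d m) *+ l by apply: exceeds; rewrite oppr_gt0.
  by have := yle l; have := y0 (m + l)%N; rewrite mulNrn; lra.
have y10 : y 1 = 0.
  apply: contrapT => /eqP y1; have {}y1 : 0 < y 1 by rewrite lt0r y1 y0.
  have y1le m : y 1 <= y m.+1.
    elim: m => // m IH; apply: le_trans IH _.
    by have := d0 m.+1; rewrite /d subr_ge0.
  have dle' l : d l <= d 0 - (k * y 1) *+ l.
    elim: l => [|l IH]; first by rewrite mulr0n subr0.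
    rewrite dS mulrS; have := ler_wpM2l (ltW k0) (y1le l); lra.
  have [l] := exceeds (d 0) _ (mulr_gt0 k0 y1).
  by have := dle' l; have := d0 l; lra.
have y00 : y 0 = 0.
  by have := d0 0%N; have := y0 0%N; rewrite /d y10; lra.
have x10 : x 1 = 0.
  move: y10 => /eqP; rewrite /y mulf_eq0 invr_eq0 expf_eq0 /= (gt_eqF r0) orbF.
  by move=> /eqP.
by move: y00; rewrite /y expr0 divr1 => x00; case: nz; rewrite ?x00 ?x10 eqxx.
Qed.

Definition re_row (R : realType) (n : nat) (x : 'rV[R[i]]_n) : 'rV[R]_n :=
  map_mx (@complex.Re R) x.

Lemma re_row_mulmx (R : realType) (n : nat) (x : 'rV[R[i]]_n) (B : 'M[R]_n) :
  re_row (x *m map_mx (real_complex R) B) = re_row x *m B.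
Proof.
apply/rowP => j; rewrite !mxE.
rewrite (big_morph (@complex.Re R) (id1 := 0) (op1 := +%R)) //; last first.
  by case=> a1 b1 [a2 b2].
apply: eq_bigr => i _; rewrite !mxE.
by case: (x 0 i) => a1 b1 /=; rewrite mulr0 subr0.
Qed.

(** This is [z^2 = 2 Re(z) z - |z|^2], after taking real parts. *)
Lemma re_row_recurrence (R : realType) (n : nat) (x : 'rV[R[i]]_n)
    (al z : R[i]) (j : 'I_n) :
  re_row ((al * z ^+ 2) *: x) 0 j =
    2 * complex.Re z * re_row ((al * z) *: x) 0 j -
    Normc.normc z ^+ 2 * re_row (al *: x) 0 j.
Proof.
rewrite !mxE; case: z => a c; case: al => a1 b1; case: (x 0 j) => a2 b2.
rewrite /= sqr_sqrtr ?addr_ge0 ?sqr_ge0 // expr2 /=; ring.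
Qed.

(** The real parts of the multiples of [x] are stable under [B ^+ m], and every
orbit of [B ^+ m] on them satisfies the recurrence whose roots are [z] and its
conjugate, whether or not [z] is real. A leading coordinate along an orbit of
persistent sign then gives [|z| <= Re z]. *)
Lemma eigenvalue_expr_ge0 (R : realType) (n b k m : nat) (B : 'M[R]_n)
    (x : 'rV[R[i]]_n) (z : R[i]) :
  (forall i j, 0 <= B i j) -> two_banded b k B -> one_residue (b + k) x ->
  x != 0 -> x *m map_mx (real_complex R) (B ^+ m) = z *: x -> z = `|z|.
Proof.
move=> B0 Bband xres xnz xz.
have [->|znz] := eqVneq z 0; first by rewrite normr0.
pose W al l := re_row ((al * z ^+ l) *: x).
have WS al l : W al l *m B ^+ m = W al l.+1.
  by rewrite /W -re_row_mulmx -scalemxAl xz scalerA exprSr mulrA.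
have Wrec al l j : W al l.+2 0 j =
    2 * complex.Re z * W al l.+1 0 j - Normc.normc z ^+ 2 * W al l 0 j.
  rewrite /W -addn2 exprD mulrA re_row_recurrence.
  by rewrite -[in RHS](addn1 l) exprD expr1 mulrA.
have r0 : 0 < Normc.normc z.
  have := normr_ge0 z; rewrite normc_def ler0c le_eqVlt => /orP[/eqP z0|].
    by move: znz; rewrite -normr_eq0 normc_def -z0 eqxx.
  by case: (z).
have Wit al l : iter l (fun u => u *m B ^+ m) (W al 0) = W al l.
  by elim: l => //= l ->.
pose K u := u != 0 /\ exists al, u = W al 0.
(* If W al 1 = 0, then W al 2 = 0 too, and the recurrence gives W al 0 = 0. *)
have Kstep u : K u -> K (u *m B ^+ m).
  case=> unz [al uE]; split; last first.
    exists (al * z); rewrite uE WS /W expr1 expr0 mulr1 //.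
  apply: contraNneq unz => Tu0; apply/eqP/rowP => j.
  have W1 : W al 1 = 0 by rewrite -WS -uE.
  have := Wrec al 0 j; rewrite -(WS al 1) W1 mul0mx uE !mxE mulr0 sub0r.
  move=> /esym/eqP; rewrite oppr_eq0 mulf_eq0 expf_eq0 /= (gt_eqF r0) /=.
  by move=> /eqP.
have K0 : exists u, K u.
  have /rV0Pn[j xj] := xnz.
  exists (W (x 0 j)^-1 0); split; last by exists (x 0 j)^-1.
  by apply/rV0Pn; exists j; rewrite !mxE expr0 mulr1 mulVf //= oner_eq0.
case: K0 => u0 Ku0.
have Kres u : K u -> one_residue (b + k) u.
  case=> _ [al ->] i j Wi Wj; apply: xres.
    by apply: contraNneq Wi; rewrite !mxE => ->; rewrite mulr0.
  by apply: contraNneq Wj; rewrite !mxE => ->; rewrite mulr0.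
have [|u|u e s Ku|u [e [[unz [al uE]] lead]]] :=
  persistent_leading_sign (T := fun u => u *m B ^+ m) Ku0.
- exact: Kstep.
- by case.
- exact: (alternation_mulmxX B0 Bband (Kres u Ku)).
(* The recurrence is followed at the first coordinate j where W al 0 or W al 1
   does not vanish: all W al t vanish before j, and (W al t 0 j) is not the
   zero sequence. *)
have exj : exists l, [exists j : 'I_n,
    (j == l :> nat) && ((W al 0 0 j != 0) || (W al 1 0 j != 0))].
  have /rV0Pn[j uj] := unz.
  by exists j; apply/existsP; exists j; rewrite -uE uj eqxx.
case: (ex_minnP exj) => l /existsP[j /andP[/eqP jl Wj]] jmin.
have Wlt (i : 'I_n) t : (i < j)%N -> W al t 0 i = 0.
  move=> ij; have [/eqP W0 /eqP W1] : W al 0 0 i == 0 /\ W al 1 0 i == 0.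
    apply/andP; rewrite -[_ && _]negbK negb_and; apply/negP => Wi.
    have : (l <= i)%N by apply: jmin; apply/existsP; exists i; rewrite eqxx.
    by rewrite -jl leqNgt ij.
  suff : W al t 0 i = 0 /\ W al t.+1 0 i = 0 by case.
  by elim: t => // t [Wt Wt1]; rewrite Wrec Wt Wt1 !mulr0 subr0.
have : Normc.normc z <= complex.Re z.
  apply: (@nonneg_recurrence _ _ _ (fun t => (-1) ^+ e * W al t 0 j)) => //.
  - move=> t; rewrite -Wit -uE; apply: lead => i ij.
    by rewrite uE Wit Wlt.
  - by move=> t; rewrite Wrec; ring.
  - by rewrite !mulf_eq0 !signr_eq0 /=; apply/orP.
rewrite normc_def; case: (z) => a c /= ca; apply/eqP.
(* sqrt (a^2 + c^2) <= a leaves only c = 0 and a >= 0. *)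
have a0 : 0 <= a by apply: le_trans ca; rewrite sqrtr_ge0.
have c0 : c = 0.
  have : a ^+ 2 + c ^+ 2 <= a ^+ 2.
    by rewrite -ler_sqrt ?sqr_ge0 // sqrtr_sqr ger0_norm.
  by rewrite gerDl => c2; apply/eqP; rewrite -sqrf_eq0 eq_le c2 sqr_ge0.
by rewrite eq_complex /= c0 expr0n addr0 sqrtr_sqr ger0_norm ?eqxx.
Qed.

(** * Roots of unity and polar form *)

Lemma expiX (R : realType) (t : R) (m : nat) : expi t ^+ m = expi (t * m%:R).
Proof.
elim: m => [|m IH]; first by rewrite expr0 mulr0 /expi cos0 sin0.
rewrite exprS IH -natr1 mulrDr mulr1 addrC /expi cosD sinD.
apply/eqP; rewrite eq_complex /= !eqxx /= addrC.
by rewrite [cos t * _]mulrC [sin t * _]mulrC.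
Qed.

(** Because [cos t = 1 - 2 * sin (t / 2) ^+ 2], and [t / 2] lies strictly
between [0] and [pi]. *)
Lemma expi_neq1 (R : realType) (t : R) : 0 < t < 2 * pi -> expi t != 1.
Proof.
move=> /andP[t0 t2]; apply/negP => /eqP[ct _].
have st : 0 < sin (t / 2) by apply: sin_gt0_pi; apply/andP; split; lra.
have := exprn_gt0 2 st; have := cos_mulr2n (t / 2).
have -> : t / 2 *+ 2 = t by lra.
rewrite ct cos2sin2; lra.
Qed.

Lemma expi_primitive_root (R : realType) (p : nat) :
  (0 < p)%N -> p.-primitive_root (expi (2 * pi / p%:R : R)).
Proof.
move=> p0; have p0R : 0 < p%:R :> R by rewrite ltr0n.
rewrite /primitive_root_of_unity p0; apply/forallP => m; apply/eqP.
rewrite unity_rootE expiX.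
have [->|mp] := eqVneq m.+1 p.
  rewrite divfK; last by rewrite gt_eqF.
  by rewrite /expi mulr_natl cos2pi sin2pi eqxx.
apply/negbTE/expi_neq1.
have ltmp : (m.+1 < p)%N by rewrite ltn_neqAle mp ltn_ord.
rewrite mulrAC; apply/andP; split.
  by rewrite divr_gt0 // mulr_gt0 ?ltr0n // mulr_gt0 // pi_gt0.
rewrite ltr_pdivrMr // ltr_pM2l ?ltr_nat //.
by rewrite mulr_gt0 // pi_gt0.
Qed.

(** [z / |z|] is a [p]-th root of unity, hence a power of [expi (2 * pi / p)]. *)
Lemma nonneg_expr_polar (R : realType) (p : nat) (z : R[i]) :
  (0 < p)%N -> z ^+ p = `|z ^+ p| ->
  exists (r : R) (j : int),
    0 <= r /\ z = r%:C * expi (2 * pi * j%:~R / p%:R).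
Proof.
move=> p0 zp; have [->|znz] := eqVneq z 0.
  by exists 0, 0; rewrite lexx mul0r.
have : (z / `|z|) ^+ p = 1.
  by rewrite expr_div_n zp normrX divff // expf_neq0 // normr_eq0.
case/(prim_rootP (expi_primitive_root R p0)) => j zj.
exists (Num.sqrt (complex.Re z ^+ 2 + complex.Im z ^+ 2)), (j : nat)%:Z.
split; first exact: sqrtr_ge0.
rewrite -normc_def mulrAC -[_%:~R]/((j : nat)%:R) -expiX -zj.
by rewrite mulrC divfK // normr_eq0.
Qed.

(** * Spectrum of two-banded matrices *)

Theorem corollary1p1 (R : realType) (b k n p : nat)
    (hb : (0 < b)%N) (hk : (0 < k)%N) (hn : (0 < n)%N)
    (hp : p = ((b + k) %/ gcdn b k)%N)
    (A : 'M[R[i]]_n)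
    (hA : forall i j : 'I_n,
        (i%:Z - j%:Z)%R <> b%:Z -> (i%:Z - j%:Z)%R <> - k%:Z -> A i j = 0) :
  rotation_invariant (2 * pi / p%:R) (spectrum A) /\
  ((forall i j : 'I_n, A i j \is Num.real /\ 0 <= A i j) ->
   forall z : R[i], z \in spectrum A ->
     exists (r : R) (j : int),
       0 <= r /\ z = r%:C * expi (2 * pi * j%:~R / p%:R)).
Proof.
have Aband : two_banded b k A.
  move=> i j; apply: contra_neqP => /not_orP[ib jk]; apply: hA; lia.
have p0 : (0 < p)%N.
  rewrite hp divn_gt0 ?gcdn_gt0 ?hb // dvdn_leq ?addn_gt0 ?hb //.
  by rewrite dvdn_addr ?dvdn_gcdl ?dvdn_gcdr.
have wprim := expi_primitive_root R p0.
split.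
  apply: (rotation_invariant_root p0 (prim_expr_order wprim)) => z.
  have [|f fA] := two_banded_grading hb hk Aband (w := expi (2 * pi / p%:R)).
    by rewrite -hp.
  apply: twisted_spectrum fA.
  apply: contra_eqN (prim_expr_order wprim) => /eqP ->.
  by rewrite expr0n (gtn_eqF p0) eq_sym oner_eq0.
move=> A0 z; rewrite inE => /eigenvalueP[v vA vnz].
apply: (nonneg_expr_polar p0).
pose B := map_mx (@complex.Re R) A.
have AE : A = map_mx (real_complex R) B.
  by apply/matrixP => i j; rewrite !mxE RRe_real //; case: (A0 i j).
have /rV0Pn[j0 vj0] := vnz.
(* p * b is the least common multiple of b and b + k, so after p steps the
   residue class returns to itself. *)
have dvd_pb : (p * b = 0 %[mod (b + k)])%N.
  apply/eqP; rewrite mod0n -/(dvdn _ _) hp.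
  have gbk : (gcdn b k %| b + k)%N by rewrite dvdn_add ?dvdn_gcdl ?dvdn_gcdr.
  by rewrite divn_mulAC // -muln_divA ?dvdn_gcdl // dvdn_mulr.
pose x := restrict_residue (b + k) j0 v.
apply: (@eigenvalue_expr_ge0 R n b k p B x).
- by move=> i j; rewrite mxE; case: (A0 i j) => _; rewrite lecE => /andP[].
- by move=> i j; rewrite mxE => Bij; apply: Aband; apply: contraNneq Bij => ->.
- move=> i j; rewrite !mxE; case: ifP => [/eqP -> _|_]; last by rewrite eqxx.
  by case: ifP => [/eqP -> _|_]; last by rewrite eqxx.
- by apply/rV0Pn; exists j0; rewrite mxE eqxx.
have -> : map_mx (real_complex R) (B ^+ p) = A ^+ p.
  rewrite [in RHS]AE; elim: (p) => [|m IH]; first exact: map_mx1.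
  by rewrite !exprS -IH; exact: map_mxM.
rewrite -(restrict_residue_mulmxX p j0 Aband vA); congr (_ *m _).
by apply/rowP => j; rewrite !mxE -[in RHS]modnDmr dvd_pb mod0n addn0.
Qed.
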